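(* Let $\mathcal H$ be a real Hilbert space and let $f:\mathcal H\to\mathbb R\cup\{+\infty\}$ be a proper lower semicontinuous convex function with $\operatorname{argmin}_{\mathcal H} f\neq\emptyset$. Let $0<d<1$, let $(\beta_k)$ be a nondecreasing sequence of positive reals with $\lim_{k\to+\infty}\beta_k=+\infty$, and write $\dot\beta_k:=\beta_{k+1}-\beta_k$. Suppose that $\dot\beta_k\neq0$ for $k$ large enough and that $$\lim_{k\to+\infty}\frac{\dot\beta_{k+1}}{\dot\beta_k}=\lim_{k\to+\infty}\frac{\beta_{k+1}}{\beta_k}=\ell>0 .$$ Let $(x_k)$ be a sequence generated by the algorithm $x_{k+1}=\operatorname{prox}_{\beta_k f}(d\,x_k)$, and let $\rho\in\,]0,1-d[$. Then: i) for $k$ large enough, $$f(x_k)-\min_{\mathcal H} f=\mathcal O\left(\frac1{\beta_k}\right),\quad \|\dot x_k\|^2=\mathcal O\left(\frac{\dot\beta_k}{\beta_k}+e^{-\rho k}\right),\quad \|x_k-y_k\|^2=\mathcal O\left(\frac{\dot\beta_k}{\beta_k}+e^{-\rho k}\right);$$ ii) if $\ell=1$, the sequence $(x_k)$ converges strongly to $x^*$, the element of minimum norm of $\operatorname{argmin}_{\mathcal H} f$; iii) for $k$ large enough, $$d(0,\partial f(x_{k+1}))=\mathcal O\left(\frac1{\beta_k}\right),$$ and if $f$ is differentiable on $\mathcal H$, then the gradients converge strongly to zero with the rate $$\|\nabla f(x_k)\|=\mathcal O\left(\frac1{\beta_k}\right).$$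
   Context: For $\lambda>0$, $\operatorname{prox}_{\lambda f}(x):=\operatorname{argmin}_{\xi\in\mathcal H}\left(\lambda f(\xi)+\frac12\|x-\xi\|^2\right)=(I+\lambda\partial f)^{-1}(x)$, where $\partial f$ is the convex subdifferential. The algorithm starts from an arbitrary initial point of $\mathcal H$. Notation: $\dot x_k:=x_{k+1}-x_k$; $\varphi_k:=f+\frac{1-d}{2\beta_k}\|\cdot\|^2$, and $y_k$ is the unique minimizer of $\varphi_k$ on $\mathcal H$; $d(0,A):=\inf_{z\in A}\|z\|$ for $A\subset\mathcal H$ (not to be confused with the scalar $d$). *)

(* Defs.v *)
From HB Require Import structures.
From mathcomp Require Import all_boot all_order all_algebra.
From mathcomp Require Import all_classical all_reals all_analysis.

Set Implicit Arguments.
Unset Strict Implicit.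
Unset Printing Implicit Defensive.

Import Order.TTheory GRing.Theory Num.Theory.
Import numFieldNormedType.Exports.

Local Open Scope classical_set_scope.
Local Open Scope ring_scope.

(* A real Hilbert space is a complete normed module [H] over [R : realType]
   together with [dot : {dot H for idfun}] such that [dot x x = `|x| ^+ 2].
   Functions H -> R U {+oo} are functions [H -> \bar R] that avoid -oo. *)

Definition proper_fun (R : realType) (H : Type) (f : H -> \bar R) : Prop :=
  (forall x, f x != -oo%E) /\ (exists x, f x != +oo%E).

(* [0 * +oo = 0] in [\bar R], so the endpoints t = 0, 1 are harmless when f
   avoids -oo. *)
Definition convex_ereal (R : realType) (H : lmodType R) (f : H -> \bar R) :
    Prop :=
  forall (x y : H) (t : R), 0 <= t <= 1 ->
    (f (t *: x + (1 - t) *: y)%R <= t%:E * f x + (1 - t)%:E * f y)%E.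

Definition argmin (R : realType) (H : Type) (f : H -> \bar R) : set H :=
  [set x | forall y, (f x <= f y)%E].

Definition minval (R : realType) (H : Type) (f : H -> \bar R) : \bar R :=
  ereal_inf (range f).

(* [get A] is an element of A as soon as A is nonempty. In [prox] and
   [tikhonov_min], for f proper lower semicontinuous convex and a positive
   quadratic coefficient, A is a singleton. *)
Definition prox (R : realType) (H : completeNormedModType R)
    (lambda : R) (f : H -> \bar R) (x : H) : H :=
  get (argmin (fun xi : H =>
    (lambda%:E * f xi + (2^-1 * `|x - xi| ^+ 2)%:E)%E)).

Definition phi (R : realType) (H : completeNormedModType R)
    (d : R) (beta : nat -> R) (f : H -> \bar R) (k : nat) : H -> \bar R :=
  fun x => (f x + ((1 - d) / (2 * beta k) * `|x| ^+ 2)%:E)%E.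

Definition tikhonov_min (R : realType) (H : completeNormedModType R)
    (d : R) (beta : nat -> R) (f : H -> \bar R) (k : nat) : H :=
  get (argmin (phi d beta f k)).

(* Empty where f = +oo, if f is proper. *)
Definition subdiff (R : realType) (H : completeNormedModType R)
    (dot : {dot H for idfun}) (f : H -> \bar R) (x : H) : set H :=
  [set z | forall y, (f x + (dot z (y - x)%R)%:E <= f y)%E].

(* d(0, A), with d(0, set0) = +oo *)
Definition dist0 (R : realType) (H : completeNormedModType R) (A : set H) :
    \bar R :=
  ereal_inf [set `|z|%:E | z in A].

(* Riesz representative of the Frechet differential of the finite-valued f. *)
Definition gradient (R : realType) (H : completeNormedModType R)
    (dot : {dot H for idfun}) (f : H -> \bar R) (x : H) : H :=
  get [set g : H | forall h : H, 'd (fine \o f : H -> R^o) x h = dot g h].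

Definition fdiff (V : zmodType) (u : nat -> V) (k : nat) : V := u k.+1 - u k.

Definition is_min_norm (R : realType) (H : completeNormedModType R)
    (A : set H) (z : H) : Prop :=
  A z /\ forall w, A w -> `|z| <= `|w|.

(* u = O(v) along nat for an extended-real u: [fine] sends infinities to 0, so
   u is also required to be eventually finite. *)
Definition ereal_bigO (R : realType) (u : nat -> \bar R) (v : nat -> R) :
    Prop :=
  (\forall k \near \oo, u k \is a fin_num) /\
  ((fine \o u : nat -> R^o) =O_\oo (v : nat -> R^o)).

(* Main.v *)
Require Import Defs.
From HB Require Import structures.
From mathcomp Require Import all_boot all_order all_algebra.
From mathcomp Require Import all_classical all_reals all_analysis.
From mathcomp Require Import ring lra.

(** The point [y k = tikhonov_min d beta f k] satisfies
    [- (1 - d) *: y k] in [beta k *: subdiff f (y k)], that is, [y k] is the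
    fixed point of the map [u |-> prox (beta k) f (d *: u)], which is
    d-Lipschitz because resolvents are nonexpansive. So each step of the
    algorithm multiplies the distance to a slowly moving target by at most d
    ([tikhonov_contraction]):
      |x_{k+1} - y_{k+1}| <= d |x_k - y_k| + |y_{k+1} - y_k|.

    Monotonicity of the subdifferential along the Tikhonov curve bounds the
    motion of the target by the relative growth r_k of beta
    ([tikhonov_drift]):
      |y_{k+1} - y_k| <= r_k |y_k|, where r_k = (beta_{k+1} - beta_k) / beta_k,
    and |y_k| <= |z| for every minimizer z of f. Since r_k is bounded, squaring gives, for a_k = |x_k - y_k|^2, a recursion
    a_{k+1} <= d a_k + C r_k. The two ratio hypotheses enter through their
    quotient, r_{k+1} / r_k --> 1: the sequence r decays more slowly than any
    geometric sequence, so the geometric averaging performed by the recursion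
    returns a multiple of r_k, up to the initial error, which decays like
    d^k <= exp (- (1 - d) k) ([recursion_bound]). The velocity is at most
    2 |x_k - y_k|.

    The bounds in 1 / beta_k come from the boundedness of the iterates:
    (d x_k - x_{k+1}) / beta_k is a subgradient at x_{k+1} of size
    O(1 / beta_k); it bounds the distance from 0 to the subdifferential, it is
    the gradient when there is one, and the subgradient inequality at a
    minimizer turns it into a bound on the values.

    When ell = 1 the rate tends to 0, so x_k - y_k --> 0, and it remains to see
    that the Tikhonov curve converges to the minimizer of least norm. Monotonicity
    gives |y_n - y_k|^2 <= |y_k|^2 - |y_n|^2 for n <= k, so the norms increase;
    they are bounded by the norm of any minimizer, hence the curve is Cauchy
    ([tikhonov_cvg]). The same scheme, with the parallelogram law in place of
    monotonicity, shows that the minimizers defining [prox] and [tikhonov_min]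
    exist ([quadratic_argmin_neq0]). *)

Set Implicit Arguments.
Unset Strict Implicit.
Unset Printing Implicit Defensive.

Import Order.TTheory GRing.Theory Num.Theory.
Import numFieldNormedType.Exports.

Local Open Scope classical_set_scope.
Local Open Scope ring_scope.

(** * Real inner products *)

Section HilbertGeometry.
Context (R : realType) (H : completeNormedModType R) (dot : {dot H for idfun}).
Implicit Types (u v w : H) (a : R).

Lemma dotC u v : dot u v = dot v u.
Proof. by rewrite (hermC dot u v) expr0 mul1r. Qed.

Lemma dotDl u v w : dot (u + v) w = dot u w + dot v w.
Proof. exact: linearDl. Qed.

Lemma dotZl a u w : dot (a *: u) w = a * dot u w.
Proof. exact: linearZl_LR. Qed.

Lemma dotNl u w : dot (- u) w = - dot u w.
Proof. exact: linearNl. Qed.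

Lemma dotDr u v w : dot w (u + v) = dot w u + dot w v.
Proof. by rewrite !(dotC w) dotDl. Qed.

Lemma dotZr a u w : dot w (a *: u) = a * dot w u.
Proof. by rewrite !(dotC w) dotZl. Qed.

Lemma dotNr u w : dot w (- u) = - dot w u.
Proof. by rewrite !(dotC w) dotNl. Qed.

Definition dot_linearE := (dotDl, dotDr, dotNl, dotNr, dotZl, dotZr).

Context (dotE : forall u, dot u u = `|u| ^+ 2).

Lemma dot_inj u v : (forall h, dot u h = dot v h) -> u = v.
Proof.
move=> uv; apply/eqP; rewrite -subr_eq0 -normr_eq0 -sqrf_eq0 -dotE.
by rewrite dotDl dotNl uv subrr.
Qed.

(** Expand the squared norm of |v| u - |u| v, then divide by |u| |v|. *)
Lemma CauchySchwarz_dot u v : dot u v <= `|u| * `|v|.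
Proof.
have [->|u0] := eqVneq u 0; first by rewrite normr0 mul0r -(scale0r 0) dotZl mul0r.
have [->|v0] := eqVneq v 0; first by rewrite normr0 mulr0 -(scale0r 0) dotZr mul0r.
have : 0 <= dot (`|v| *: u - `|u| *: v) (`|v| *: u - `|u| *: v).
  by rewrite dotE sqr_ge0.
rewrite !dot_linearE !dotE (dotC v u).
have : 0 < `|u| * `|v| by rewrite mulr_gt0 ?normr_gt0.
set p := `|u|; set q := `|v|; set t := dot u v => pq0 h.
rewrite -(ler_pM2l pq0); nra.
Qed.

Lemma sqr_normB u v : `|u - v| ^+ 2 = `|u| ^+ 2 - 2 * dot u v + `|v| ^+ 2.
Proof. by rewrite -!dotE !dot_linearE (dotC v u); ring. Qed.

(** The parallelogram law, centred at w: this is the uniform convexity that makes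
    minimizing sequences of quadratically perturbed functions Cauchy. *)
Lemma sqr_norm_midpoint w u v :
  `|w - (2^-1 *: u + (1 - 2^-1) *: v)| ^+ 2 =
  (`|w - u| ^+ 2 + `|w - v| ^+ 2) / 2 - `|u - v| ^+ 2 / 4.
Proof.
rewrite -!dotE !dot_linearE (dotC v u) (dotC u w) (dotC v w).
by field.
Qed.

End HilbertGeometry.

(** * Real sequences *)

Section RealLemmas.
Context (R : realType).

(** Replaces a derivative at 0: it lets t tend to 0 in an inequality along a
    segment. *)
Lemma le_of_le_add_mul (p q K : R) :
  0 <= K -> (forall t, 0 < t <= 1 -> p <= q + t * K) -> p <= q.
Proof.
move=> K0 h; apply/ler_addgt0Pr => e e0.
have K1 : 0 < K + 1 by rewrite ltr_wpDl.
have t0 : 0 < Num.min 1 (e / (K + 1)) by rewrite lt_min ltr01 divr_gt0.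
have := h _ (introT andP (conj t0 _)); rewrite ge_min lexx => /(_ isT).
move=> /le_trans; apply; rewrite lerD2l.
apply: (@le_trans _ _ (e / (K + 1) * K)).
  by rewrite ler_wpM2r// ge_min lexx orbT.
by rewrite -mulrA ler_piMr ?(ltW e0)// mulrC ler_pdivrMr// mul1r lerDl.
Qed.

(** A forcing term r with r_{k+1} / r_k --> 1 eventually satisfies
    q r_k <= r_{k+1} for q = (1 + d) / 2 > d, so M1 r_k with M1 = C / (q - d) is a
    supersolution: d M1 r_k + C r_k = q M1 r_k <= M1 r_{k+1}. The exponential is
    another one, for the unforced recursion, because d <= 1 - rho <= exp (- rho);
    it absorbs the value of a at the rank where these estimates start. *)
Lemma recursion_bound (a r : nat -> R) (d rho C : R) :
  0 < d < 1 -> 0 < rho < 1 - d -> 0 <= C -> (forall k, 0 <= r k) ->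
  (\forall k \near \oo, a k.+1 <= d * a k + C * r k) ->
  r k.+1 / r k @[k --> \oo] --> (1 : R) ->
  exists2 M, 0 < M & \forall k \near \oo, a k <= M * (r k + expR (- (rho * k%:R))).
Proof.
move=> /andP[d0 d1] /andP[rho0 rhod] C0 r0 arec rlim.
pose q := (1 + d) / 2.
have qd : 0 < q - d by rewrite /q; lra.
have q0 : 0 < q by rewrite /q; lra.
have rq : \forall k \near \oo, q * r k <= r k.+1.
  have /cvgr_gt/(_ q) : r k.+1 / r k @[k --> \oo] --> (1 : R) by [].
  have q1 : q < 1 by rewrite /q; lra.
  move=> /(_ q1); apply: filterS => k.
  have [->|rk0] := eqVneq (r k) 0; first by rewrite mulr0.
  have rk : 0 < r k by rewrite lt_neqAle eq_sym rk0 r0.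
  by rewrite ltr_pdivlMr// => /ltW.
have dexp : d <= expR (- rho).
  by apply: le_trans (expR_ge1Dx _); lra.
case: arec rq => [K1 _ hK1] [K2 _ hK2]; pose K := maxn K1 K2.
have Krec k : (K <= k)%N -> a k.+1 <= d * a k + C * r k.
  by move=> Kk; apply: hK1; apply: leq_trans Kk; rewrite leq_maxl.
have Kq k : (K <= k)%N -> q * r k <= r k.+1.
  by move=> Kk; apply: hK2; apply: leq_trans Kk; rewrite leq_maxr.
pose M1 := C / (q - d).
have M10 : 0 <= M1 by rewrite divr_ge0// ltW.
pose M2 := `|a K| / expR (- (rho * K%:R)).
have M20 : 0 <= M2 by rewrite divr_ge0// expR_ge0.
have key n : a (K + n)%N <= M1 * r (K + n)%N + M2 * expR (- (rho * (K + n)%:R)).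
  elim: n => [|n IHn].
    rewrite addn0 /M2 divfK ?gt_eqF ?expR_gt0//.
    by rewrite (le_trans (ler_norm _))// lerDr mulr_ge0.
  rewrite addnS; apply: (le_trans (Krec _ (leq_addr _ _))).
  have hM1 : C = M1 * (q - d) by rewrite /M1 divfK// gt_eqF.
  have h1 := ler_wpM2l M10 (Kq _ (leq_addr n K)).
  have h2 := ler_wpM2l (ltW d0) IHn.
  have -> : expR (- (rho * (K + n).+1%:R)) = expR (- rho) * expR (- (rho * (K + n)%:R)).
    by rewrite -expRD -natr1; congr expR; ring.
  have h3 : d * (M2 * expR (- (rho * (K + n)%:R)))
      <= expR (- rho) * (M2 * expR (- (rho * (K + n)%:R))).
    by rewrite ler_wpM2r// mulr_ge0// expR_ge0.
  rewrite hM1; lra.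
exists (M1 + M2 + 1); first by rewrite ltr_wpDl// addr_ge0.
exists K => // k /= Kk; rewrite -(subnKC Kk).
apply: (le_trans (key _)).
have := expR_gt0 (- (rho * (K + (k - K))%:R)).
move: (r0 (K + (k - K))%N) => + /ltW.
move: (r _) (expR _) => s e s0 e0.
have := mulr_ge0 M20 s0; have := mulr_ge0 M10 e0.
rewrite !mulrDl !mulrDr; lra.
Qed.

End RealLemmas.

Lemma eqO_near (R : realType) (V : normedModType R) (u : nat -> V) (v : nat -> R)
    (M : R) :
  0 < M -> (\forall k \near \oo, `|u k| <= M * v k) -> u =O_\oo (v : nat -> R^o).
Proof.
move=> M0 h; apply/eqO_exP; exists M => //; apply: filterS h => k /le_trans; apply.
by rewrite ler_pM2l// ler_norm.
Qed.

(** * Limits in a complete space *)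

Section Limits.
Context (R : realType) (H : completeNormedModType R).

(** Squared distances are what both the parallelogram law and the Tikhonov curve
    provide. *)
Lemma cvg_of_sqr_dist (u : nat -> H) (e : nat -> R) :
  (forall n k, (n <= k)%N -> `|u n - u k| ^+ 2 <= e n) ->
  e k @[k --> \oo] --> (0 : R) -> cvgn u.
Proof.
move=> ue e0; apply/cauchy_cvgP/cauchy_exP => eps eps0.
have : \forall n \near \oo, e n < eps ^+ 2.
  by move/cvgr_lt: e0; apply; rewrite exprn_gt0.
case=> N _ hN; exists (u N); exists N => // k /= Nk.
rewrite -ball_normE /= -(ltr_pXn2r (n := 2))// ?nnegrE ?(ltW eps0) ?normr_ge0//.
by apply: le_lt_trans (ue _ _ Nk) (hN _ _) => /=.
Qed.

(** Lower semicontinuity in the only form used below: real bounds along a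
    convergent sequence pass to the limit. *)
Lemma lsc_le_lim (f : H -> \bar R) (u : nat -> H) (v : H) (b : nat -> R) (l : R) :
  lower_semicontinuous f -> u k @[k --> \oo] --> v ->
  b k @[k --> \oo] --> l -> (forall k, f (u k) <= (b k)%:E)%E -> (f v <= l%:E)%E.
Proof.
move=> flsc uv bl fub; rewrite leNgt; apply/negP => lf.
have [a la af] : exists2 a, l < a & (a%:E < f v)%E.
  case: (f v) lf => [r| |//].
    rewrite lte_fin => lr; exists ((l + r) / 2); rewrite ?lte_fin; lra.
  by move=> _; exists (l + 1); rewrite ?ltrDl ?ltry.
have [V Vv hV] := flsc _ _ af.
have /cvgr_lt/(_ _ la) ba := bl.
have /= uV := uv _ Vv.
have [N _ hN] := filterI ba uV.
have [/= bN uN] := hN N (leqnn N).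
have := lt_le_trans (hV _ uN) (fub N).
by rewrite lte_fin ltNge (ltW bN).
Qed.

End Limits.

(** * Convex functions and their proximal points *)

Section ConvexAnalysis.
Context (R : realType) (H : completeNormedModType R) (dot : {dot H for idfun}).
Context (dotE : forall u, dot u u = `|u| ^+ 2).
Context (f : H -> \bar R).

Section Proper.
Context (f_proper : proper_fun f).

Lemma proper_gtNy u : (-oo < f u)%E.
Proof. by rewrite ltNye; case: f_proper. Qed.

Lemma argmin_fin u : argmin f u -> f u \is a fin_num.
Proof.
case: f_proper => fNy [w fw] /(_ w) uw; rewrite fin_numElt proper_gtNy /=.
by apply: le_lt_trans uw _; rewrite ltey.
Qed.

Lemma subdiff_fin u z : subdiff dot f u z -> f u \is a fin_num.
Proof.
case: f_proper => fNy [w fw] /(_ w) uw; rewrite fin_numElt proper_gtNy /=.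
rewrite ltey; apply/eqP => fu; move: uw; rewrite fu addye// leye_eq.
by apply/negP.
Qed.

Lemma argmin_subdiff0 u : argmin f u -> subdiff dot f u 0.
Proof.
by move=> fu y; rewrite -(scale0r 0) dotZl mul0r adde0.
Qed.

(** Add the two subgradient inequalities; properness makes the values finite, so
    that they cancel. *)
Lemma subdiff_monotone u v zu zv : subdiff dot f u zu -> subdiff dot f v zv ->
  0 <= dot (zu - zv) (u - v).
Proof.
move=> zfu zfv; have := zfu v; have := zfv u.
rewrite -(fineK (subdiff_fin zfu)) -(fineK (subdiff_fin zfv)) !lee_fin.
by rewrite !(dot_linearE dot); lra.
Qed.

(** Monotonicity gives |u - v|^2 <= <a - b, u - v>, then Cauchy-Schwarz. It is
    stated for points known by their subgradients, so that it applies to iterates,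
    to points of the Tikhonov curve and to minimizers alike. *)
Lemma resolvent_nonexpansive (lambda : R) (a b u v : H) : 0 < lambda ->
  subdiff dot f u (lambda^-1 *: (a - u)) -> subdiff dot f v (lambda^-1 *: (b - v)) ->
  `|u - v| <= `|a - b|.
Proof.
move=> l0 hu hv; have := subdiff_monotone hu hv.
rewrite -scalerBr dotZl pmulr_rge0 ?invr_gt0// => h.
have : `|u - v| ^+ 2 <= dot (a - b) (u - v).
  rewrite -dotE -subr_ge0 (le_trans h)// le_eqVlt; apply/orP; left; apply/eqP.
  by rewrite !(dot_linearE dot); ring.
move=> /le_trans/(_ (CauchySchwarz_dot dotE _ _)).
have [->|uv0] := eqVneq `|u - v| 0; first by rewrite normr_ge0.
by rewrite expr2 ler_pM2r// lt_neqAle eq_sym uv0 normr_ge0.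
Qed.

Context (f_convex : convex_ereal f) (f_lsc : lower_semicontinuous f).

Let F (c : R) (a u : H) : \bar R := (f u + (c * `|a - u| ^+ 2)%:E)%E.

(** A minimizing sequence is Cauchy: by convexity the value at the midpoint of two
    points that are e-optimal is at most the infimum plus e minus c |v - w|^2 / 4,
    hence |v - w|^2 <= 4 e / c. Its limit is a minimizer by lower semicontinuity.
    The infimum is finite because f is bounded below by its minimum. *)
Lemma quadratic_argmin_neq0 (c : R) (a : H) : 0 < c -> argmin f !=set0 ->
  argmin (F c a) !=set0.
Proof.
move=> c0 [z zmin]; have zfin := argmin_fin zmin.
have m_fin : ereal_inf (range (F c a)) \is a fin_num.
  rewrite fin_numElt; apply/andP; split.
    apply: (@lt_le_trans _ _ (f z)); first exact: proper_gtNy.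
    apply: le_ereal_inf_tmp => _ [u _ <-].
    by rewrite /F (le_trans (zmin u))// leeDl// lee_fin mulr_ge0// ltW.
  apply: (@le_lt_trans _ _ (F c a z)); first by apply: ereal_inf_lbound; exists z.
  by rewrite /F -(fineK zfin) ltry.
set m := ereal_inf _ in m_fin *.
pose r := fine m.
have mr : m = r%:E by rewrite /r fineK.
have Fge u : (r%:E <= F c a u)%E by rewrite -mr; apply: ereal_inf_lbound; exists u.
have /choice[u hu] : forall n : nat, exists w, (F c a w <= (r + n.+1%:R^-1)%:E)%E.
  move=> n; have n0 : 0 < (n.+1%:R : R)^-1 by rewrite invr_gt0.
  have [_ [w _ <-] hw] := lb_ereal_inf_adherent n0 m_fin.
  by exists w; rewrite EFinD -mr ltW.
have close v w (e : R) : (F c a v <= (r + e)%:E)%E -> (F c a w <= (r + e)%:E)%E ->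
    `|v - w| ^+ 2 <= 4 / c * e.
  move=> hv hw.
  have i2 : 0 <= (2^-1 : R) <= 1 by apply/andP; split; lra.
  have := Fge (2^-1 *: v + (1 - 2^-1) *: w).
  rewrite /F (sqr_norm_midpoint dotE).
  have := f_convex v w i2.
  move: hv hw; rewrite /F.
  case: (f v) (proper_gtNy v) => [fv| |]// _.
  case: (f w) (proper_gtNy w) => [fw| |]// _.
  case: (f (_ + _)) => [fm| |]//; rewrite -?EFinM -?EFinD ?lee_fin => h1 h2 h3 h4 //.
  have ce : c * (4 / c * e) = 4 * e by field; rewrite gt_eqF.
  rewrite -(ler_pM2l c0) ce; lra.
have e0 : (n.+1%:R^-1 : R) @[n --> \oo] --> (0 : R) by exact: cvg_harmonic.
have /cvg_ex[v uv] : cvgn u.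
  apply: (@cvg_of_sqr_dist _ _ _ (fun n => 4 / c * n.+1%:R^-1)).
    move=> n k nk; apply: close => //; apply: le_trans (hu k) _.
    by rewrite lee_fin lerD2l lef_pV2 ?posrE// ler_nat.
  by rewrite -[X in _ --> X](mulr0 (4 / c)); apply: cvgMr.
exists v => w; apply: le_trans (Fge w).
have : (f v <= (r - c * `|a - v| ^+ 2)%:E)%E.
  apply: (@lsc_le_lim _ _ _ u _ (fun n => r + n.+1%:R^-1 - c * `|a - u n| ^+ 2)) => //.
    have un : `|a - u k| @[k --> \oo] --> `|a - v|.
      by apply: cvg_norm; apply: cvgB => //; exact: cvg_cst.
    apply: cvgB.
      by rewrite -[X in _ --> X]addr0; apply: cvgD => //; exact: cvg_cst.
    by apply: cvgMr; rewrite expr2; under eq_fun do rewrite expr2; exact: cvgM.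
  move=> k; have := hu k; rewrite /F.
  case: (f (u k)) => [fk| |] //; last by move=> _; exact: leNye.
  by rewrite -EFinD !lee_fin lerBrDr.
rewrite /F; case: (f v) => [fv| |] //; last by move=> _; exact: leNye.
by rewrite -EFinD !lee_fin lerBrDr.
Qed.

(** Fermat's rule and the sum rule at once: compare the minimizer u with
    u + t (y - u), divide by t, and let t tend to 0. *)
Lemma quadratic_argmin_subdiff (c : R) (a u : H) : 0 < c -> argmin (F c a) u ->
  subdiff dot f u ((2 * c) *: (a - u)).
Proof.
move=> c0 umin.
have ufin : f u \is a fin_num.
  case: f_proper => _ [w fw]; rewrite fin_numElt proper_gtNy ltey.
  apply/eqP => fu; have := umin w; rewrite /F fu addye// leye_eq.
  by case: (f w) fw.
move=> y; case fy : (f y) (proper_gtNy y) => [s| |]// _; last by rewrite leey.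
rewrite -(fineK ufin) -EFinD lee_fin.
apply: (@le_of_le_add_mul _ _ _ (c * `|y - u| ^+ 2)).
  by rewrite mulr_ge0// ltW.
move=> t /andP[t0 t1].
have t01 : 0 <= t <= 1 by rewrite (ltW t0).
have := f_convex y u t01; have := umin (t *: y + (1 - t) *: u).
rewrite /F -(fineK ufin) fy.
have -> : a - (t *: y + (1 - t) *: u) = (a - u) - t *: (y - u).
  by rewrite scalerBl scalerBr scale1r !opprD !opprK !addrA (addrAC a).
rewrite (sqr_normB dotE (a - u)) dotZr normrZ exprMn gtr0_norm//.
rewrite dotZl.
move: `|a - u| `|y - u| (dot _ _) => p q s'.
case: (f (_ + _)) => [fm| |]//; rewrite -?EFinM -?EFinD ?lee_fin => h1 h2 //.
rewrite -(ler_pM2l t0); nra.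
Qed.

(** [prox lambda f a] also minimizes f + (2 lambda)^-1 |a - .|^2, obtained by
    dividing by lambda. *)
Lemma prox_subdiff (lambda : R) (a : H) : 0 < lambda -> argmin f !=set0 ->
  subdiff dot f (prox lambda f a) (lambda^-1 *: (a - prox lambda f a)).
Proof.
move=> l0 fmin.
have c0 : 0 < (2 * lambda)^-1 by rewrite invr_gt0 mulr_gt0.
have -> : lambda^-1 = 2 * (2 * lambda)^-1 by field; rewrite gt_eqF.
suff : argmin (F (2 * lambda)^-1 a) (prox lambda f a).
  exact: quadratic_argmin_subdiff.
have scaled u : (lambda%:E * F (2 * lambda)^-1 a u =
    lambda%:E * f u + (2^-1 * `|a - u| ^+ 2)%:E)%E.
  rewrite /F muleDr// -?EFinM ?mulrA.
    by congr (_ + (_ * _)%:E)%E; field; rewrite gt_eqF.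
  by rewrite /adde_def /= !andbF.
have <- : argmin (fun xi => (lambda%:E * f xi + (2^-1 * `|a - xi| ^+ 2)%:E)%E)
    = argmin (F (2 * lambda)^-1 a).
  by apply/seteqP; split=> u hu w; have := hu w; rewrite -!scaled lee_pmul2l.
have [u hu] := quadratic_argmin_neq0 a c0 fmin.
apply: (@getPex _ (argmin _)); exists u => w.
by rewrite -!scaled lee_pmul2l.
Qed.

Lemma tikhonov_min_subdiff (d : R) (beta : nat -> R) k :
  d < 1 -> 0 < beta k -> argmin f !=set0 ->
  subdiff dot f (tikhonov_min d beta f k)
    (- ((1 - d) / beta k *: tikhonov_min d beta f k)).
Proof.
move=> d1 b0 fmin.
have c0 : 0 < (1 - d) / (2 * beta k) by rewrite divr_gt0 ?mulr_gt0 ?subr_gt0.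
have -> : (1 - d) / beta k = 2 * ((1 - d) / (2 * beta k)).
  by field; rewrite gt_eqF.
rewrite -scalerN -[- tikhonov_min _ _ _ _]add0r.
suff : argmin (F ((1 - d) / (2 * beta k)) 0) (tikhonov_min d beta f k).
  exact: quadratic_argmin_subdiff.
have phiE : phi d beta f k = F ((1 - d) / (2 * beta k)) 0.
  by apply/funext => u; rewrite /phi /F sub0r normrN.
rewrite /tikhonov_min phiE.
have [u hu] := quadratic_argmin_neq0 0 c0 fmin.
by apply: (@getPex _ (argmin _)); exists u.
Qed.

(** * The Tikhonov curve *)

(** Monotonicity of the subdifferential reads
    (e1 + e2) |u - v|^2 <= (e1 - e2) (|v|^2 - |u|^2). If e1 = e2 then u = v;
    otherwise divide by e1 - e2 and use e1 - e2 <= e1 + e2. *)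
Lemma tikhonov_dist (e1 e2 : R) (u v : H) : 0 < e2 -> e2 <= e1 ->
  subdiff dot f u (- (e1 *: u)) -> subdiff dot f v (- (e2 *: v)) ->
  `|u - v| ^+ 2 <= `|v| ^+ 2 - `|u| ^+ 2.
Proof.
move=> e20 e21 hu hv; have := subdiff_monotone hu hv.
rewrite !(dot_linearE dot) (dotC dot v u) !dotE => h1.
have key : (e1 + e2) * `|u - v| ^+ 2 <= (e1 - e2) * (`|v| ^+ 2 - `|u| ^+ 2).
  by rewrite (sqr_normB dotE); lra.
have [e12|e12] := eqVneq e1 e2.
  have : `|u - v| ^+ 2 <= 0.
    have e0 : 0 < e1 + e2 by rewrite addr_gt0// e12.
    by rewrite -(pmulr_rle0 _ e0) (le_trans key)// e12 subrr mul0r.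
  rewrite le_eqVlt ltNge sqr_ge0 orbF sqrf_eq0 normr_eq0 subr_eq0 => /eqP ->.
  by rewrite !subrr normr0 expr0n.
have {}e12 : 0 < e1 - e2 by rewrite subr_gt0 lt_neqAle eq_sym e12.
rewrite -(ler_pM2l e12) (le_trans _ key)// ler_wpM2r ?sqr_ge0//.
by rewrite lerD2l (le_trans _ (ltW e20))// oppr_le0 ltW.
Qed.

(** Unlike [tikhonov_dist], this bound is linear in the distance, with a factor
    (e1 - e2) / e2 that becomes the relative growth of beta. *)
Lemma tikhonov_step (e1 e2 : R) (u v : H) : 0 < e2 -> e2 <= e1 ->
  subdiff dot f u (- (e1 *: u)) -> subdiff dot f v (- (e2 *: v)) ->
  e2 * `|v - u| <= (e1 - e2) * `|u|.
Proof.
move=> e20 e21 hu hv.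
have h : e2 * `|v - u| ^+ 2 <= (e1 - e2) * dot u (v - u).
  have := subdiff_monotone hu hv.
  by rewrite -dotE !(dot_linearE dot) (dotC dot v u); lra.
have [->|uv0] := eqVneq `|v - u| 0.
  by rewrite mulr0 mulr_ge0// subr_ge0.
have uv : 0 < `|v - u| by rewrite lt_neqAle eq_sym uv0 normr_ge0.
rewrite -(ler_pM2r uv) -!mulrA -expr2 (le_trans h)// ler_wpM2l ?subr_ge0//.
exact: CauchySchwarz_dot.
Qed.

(** Monotonicity between u and the subgradient 0 at z gives |u|^2 <= <u, z>. *)
Lemma tikhonov_norm_le (e : R) (u z : H) : 0 < e -> argmin f z ->
  subdiff dot f u (- (e *: u)) -> `|u| <= `|z|.
Proof.
move=> e0 zmin hu; have := subdiff_monotone hu (argmin_subdiff0 zmin).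
rewrite subr0 dotNl dotZl -mulrN pmulr_rge0// oppr_ge0 dotDr dotNr dotE.
rewrite subr_le0 => /le_trans/(_ (CauchySchwarz_dot dotE _ _)).
have [->|u0] := eqVneq `|u| 0; first by rewrite normr_ge0.
by rewrite expr2 ler_pM2l// lt_neqAle eq_sym u0 normr_ge0.
Qed.

(** The squared norms increase and are bounded by the norm of any minimizer; by
    [tikhonov_dist] their convergence makes y a Cauchy sequence. The subgradient
    inequality at y_k bounds f (y_k) by the minimum plus O(e_k), so the limit is a
    minimizer, and the norm bound passes to the limit. *)
Lemma tikhonov_cvg (e : nat -> R) (y : nat -> H) : argmin f !=set0 ->
  (forall k, 0 < e k) -> nonincreasing_seq e -> e k @[k --> \oo] --> (0 : R) ->
  (forall k, subdiff dot f (y k) (- (e k *: y k))) ->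
  exists2 xstar, is_min_norm (argmin f) xstar & y k @[k --> \oo] --> xstar.
Proof.
move=> [z zmin] e0 edec elim hy.
have ynd : nondecreasing_seq (fun k => `|y k| ^+ 2).
  move=> n k nk; rewrite -subr_ge0.
  exact: le_trans (tikhonov_dist (e0 k) (edec _ _ nk) (hy n) (hy k)).
have ycvg : cvgn (fun k => `|y k| ^+ 2).
  apply: nondecreasing_is_cvgn => //; exists (`|z| ^+ 2) => _ [k _ <-].
  by rewrite lerXn2r ?nnegrE// (tikhonov_norm_le (e0 k) zmin (hy k)).
have /cvg_ex[v yv] : cvgn y.
  apply: (@cvg_of_sqr_dist _ _ _ (fun n => limn (fun k => `|y k| ^+ 2) - `|y n| ^+ 2)).
    move=> n k nk.
    apply: (le_trans (tikhonov_dist (e0 k) (edec _ _ nk) (hy n) (hy k))).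
    by rewrite lerD2r; exact: (nondecreasing_cvgn_le ynd ycvg k).
  rewrite -[X in _ --> X](subrr (limn (fun k => `|y k| ^+ 2))).
  by apply: cvgB => //; exact: cvg_cst.
exists v => //; split.
  have zfin := argmin_fin zmin.
  move=> w; apply: le_trans (zmin w).
  rewrite -(fineK zfin).
  apply: (@lsc_le_lim _ _ _ y _ (fun k => fine (f z) + e k * (2 * `|z| ^+ 2))) => //.
    rewrite -[X in _ --> X]addr0; apply: cvgD; first exact: cvg_cst.
    by rewrite -[X in _ --> X](mul0r (2 * `|z| ^+ 2)); apply: cvgMl.
  move=> k; have := hy k z.
  have yz := tikhonov_norm_le (e0 k) zmin (hy k).
  rewrite -(fineK (subdiff_fin (hy k))) -(fineK zfin) -EFinD !lee_fin fineK//.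
  rewrite dotNl dotZl -lerBrDr opprK => /le_trans; apply.
  rewrite lerD2l ler_wpM2l ?(ltW (e0 k))//.
  apply: le_trans (CauchySchwarz_dot dotE _ _) _.
  have : `|z - y k| <= `|z| + `|y k| by rewrite ler_normB.
  move: (normr_ge0 (y k)); nra.
move=> w wmin; apply: (cvgr_to_le (cvg_norm yv)).
by apply: nearW => k; exact: tikhonov_norm_le (e0 k) wmin (hy k).
Qed.

End Proper.

(** * Gradients, minimal values and distances *)

(** A subgradient z is below every difference quotient with positive step, so
    <z, h> <= df(h); the same inequality at - h gives equality. *)
Lemma gradient_eq_subgradient (u z : H) : (forall w, f w \is a fin_num) ->
  differentiable (fine \o f : H -> R^o) u -> subdiff dot f u z ->
  gradient dot f u = z.
Proof.
move=> ffin fdiff hz.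
have ge_dot h : dot z h <= 'd (fine \o f : H -> R^o) u h.
  rewrite -deriveE//.
  have /cvgrPdist_lt hlim := @diff_derivable _ _ _ _ _ h fdiff.
  apply/ler_addgt0Pl => eps eps0.
  have [/= r r0 hr] := hlim _ eps0.
  have t0 : 0 < r / 2 by rewrite divr_gt0.
  have h1 : dot z h <= (r / 2)^-1 * (fine (f ((r / 2) *: h + u)) - fine (f u)).
    have := hz ((r / 2) *: h + u).
    rewrite -(fineK (ffin u)) -(fineK (ffin (_ + _))) -EFinD lee_fin /= addrK.
    by rewrite dotZr ler_pdivlMl// lerBrDl.
  have := hr (r / 2); rewrite /= sub0r normrN gtr0_norm// ltr_pdivrMr// ltr_pMr// ltr1n.
  move=> /(_ isT (lt0r_neq0 t0)); rewrite ltr_distlC => /andP[_ h2].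
  by apply: le_trans h1 _; rewrite [leRHS]addrC; exact: ltW.
have dE h : 'd (fine \o f : H -> R^o) u h = dot z h.
  apply/eqP; rewrite eq_le ge_dot andbT -lerN2.
  by rewrite -dotNr -linearN; exact: ge_dot.
apply: (dot_inj dotE) => h; rewrite -dE.
have := @getPex _ [set g | forall h, 'd (fine \o f : H -> R^o) u h = dot g h].
by move=> /(_ (ex_intro _ z dE))/(_ h).
Qed.

End ConvexAnalysis.

Lemma minvalE (R : realType) (T : Type) (f : T -> \bar R) (z : T) :
  argmin f z -> minval f = f z.
Proof.
move=> zmin; apply/eqP; rewrite eq_le; apply/andP; split.
  by apply: ereal_inf_lbound; exists z.
by apply: le_ereal_inf_tmp => _ [w _ <-]; exact: zmin.
Qed.

Lemma dist0_mem_le (R : realType) (H : completeNormedModType R) (A : set H)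
    (g : H) : A g ->
  dist0 A \is a fin_num /\ 0 <= fine (dist0 A) <= `|g|.
Proof.
move=> Ag.
have ub : (dist0 A <= `|g|%:E)%E by apply: ereal_inf_lbound; exists g.
have lb : (0 <= dist0 A)%E by apply: le_ereal_inf_tmp => _ [h _ <-]; rewrite lee_fin.
have fin : dist0 A \is a fin_num.
  by rewrite fin_numElt (lt_le_trans _ lb)// (le_lt_trans ub)// ltry.
by split => //; rewrite fine_ge0//= -lee_fin fineK.
Qed.

(** * The damped proximal algorithm *)

Section DampedProx.
Context (R : realType) (H : completeNormedModType R) (dot : {dot H for idfun})
  (dotE : forall x : H, dot x x = `|x| ^+ 2)
  (f : H -> \bar R) (f_proper : proper_fun f) (f_lsc : lower_semicontinuous f)
  (f_convex : convex_ereal f) (z : H) (zmin : argmin f z)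
  (d : R) (d01 : 0 < d < 1)
  (beta : nat -> R) (beta_nd : nondecreasing_seq beta)
  (beta_gt0 : forall k, 0 < beta k)
  (x : nat -> H) (x_algo : forall k, x k.+1 = prox (beta k) f (d *: x k)).

Let d0 : 0 < d. Proof. by case/andP: d01. Qed.
Let d1 : d < 1. Proof. by case/andP: d01. Qed.
Let y k := tikhonov_min d beta f k.
Let r k := fdiff beta k / beta k.

Lemma iterate_subdiff k :
  subdiff dot f (x k.+1) ((beta k)^-1 *: (d *: x k - x k.+1)).
Proof. by rewrite x_algo; apply: prox_subdiff => //; exists z. Qed.

Lemma tikhonov_point_subdiff k : subdiff dot f (y k) (- ((1 - d) / beta k *: y k)).
Proof. by apply: tikhonov_min_subdiff => //; exists z. Qed.

(** y_k is the fixed point of u |-> prox (beta k) f (d u): rewrite its subgradient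
    - (1 - d) y_k / beta_k as (d y_k - y_k) / beta_k. *)
Lemma tikhonov_contraction k : `|x k.+1 - y k| <= d * `|x k - y k|.
Proof.
have yfix : subdiff dot f (y k) ((beta k)^-1 *: (d *: y k - y k)).
  have := tikhonov_point_subdiff k.
  rewrite -[X in _ *: (_ - X)]scale1r -scalerBl scalerA -scaleNr.
  by rewrite -mulNr opprB mulrC.
apply: le_trans (resolvent_nonexpansive dotE f_proper (beta_gt0 k)
  (iterate_subdiff k) yfix) _.
by rewrite -scalerBr normrZ gtr0_norm.
Qed.

(** Minimizers are fixed by the proximal map, so
    |x_{k+1} - z| <= |d x_k - z| <= d |x_k - z| + (1 - d) |z|, a convex
    combination: any common bound of |x_0 - z| and |z| propagates. *)
Lemma iterate_bounded : exists2 B, 0 < B & forall k, `|x k - z| <= B.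
Proof.
exists (`|x 0%N - z| + `|z| + 1); first by rewrite ltr_wpDl// addr_ge0.
elim=> [|k IHk]; first by rewrite -addrA lerDl addr_ge0.
have zfix : subdiff dot f z ((beta k)^-1 *: (z - z)).
  by rewrite subrr scaler0; exact: argmin_subdiff0.
apply: (le_trans (resolvent_nonexpansive dotE f_proper (beta_gt0 k)
  (iterate_subdiff k) zfix)).
have -> : d *: x k - z = d *: (x k - z) - (1 - d) *: z.
  by rewrite scalerBr scalerBl scale1r opprB addrA subrK.
apply: (le_trans (ler_normB _ _)).
rewrite !normrZ gtr0_norm// gtr0_norm ?subr_gt0//.
have := ler_wpM2l (ltW d0) IHk; have := normr_ge0 (x 0%N - z).
by move: `|x 0%N - z| `|z| `|x k - z| d0 d1 => p m a dgt0 dlt1; nra.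
Qed.

Lemma residual_bounded : exists2 B, 0 < B & forall k, `|d *: x k - x k.+1| <= B.
Proof.
have [B B0 hB] := iterate_bounded.
exists (B + B + `|z|); first by rewrite ltr_wpDr// addr_gt0.
move=> k.
have -> : d *: x k - x k.+1 = d *: (x k - z) - (x k.+1 - z) - (1 - d) *: z.
  rewrite scalerBr scalerBl scale1r !opprB.
  by rewrite addrAC !addrA !subrK.
apply: (le_trans (ler_normB _ _)); rewrite lerD//.
  apply: (le_trans (ler_normB _ _)); rewrite lerD// normrZ gtr0_norm//.
  by rewrite (le_trans _ (hB k))// ler_piMl// ltW.
by rewrite normrZ gtr0_norm ?subr_gt0// ler_piMl// gerBl ltW.
Qed.

Lemma subgradient_bounded : exists2 C, 0 < C &
  forall k, `|(beta k)^-1 *: (d *: x k - x k.+1)| <= C / beta k.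
Proof.
have [B B0 hB] := residual_bounded; exists B => // k.
by rewrite normrZ gtr0_norm ?invr_gt0// mulrC ler_pM2r ?invr_gt0.
Qed.

(** The subgradient inequality at x_{k+1}, tested at the minimizer z. *)
Lemma objective_gap : exists2 C, 0 < C &
  forall k, fine (f (x k.+1)) - fine (f z) <= C / beta k.
Proof.
have [B B0 hB] := iterate_bounded; have [B' B'0 hB'] := subgradient_bounded.
exists (B' * B); first by rewrite mulr_gt0.
move=> k; have := iterate_subdiff k z.
rewrite -(fineK (subdiff_fin f_proper (iterate_subdiff k))).
rewrite -(fineK (argmin_fin f_proper zmin)) -EFinD lee_fin /= => h.
have -> : fine (f (x k.+1)) - fine (f z) <= B' * B / beta k =
    (fine (f (x k.+1)) <= fine (f z) + B' * B / beta k) by rewrite lerBlDl.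
rewrite -(lerD2r (dot ((beta k)^-1 *: (d *: x k - x k.+1)) (z - x k.+1))).
apply: (le_trans h); rewrite -addrA lerDl -(opprB (x k.+1) z) dotNr subr_ge0.
by rewrite (le_trans (CauchySchwarz_dot dotE _ _))// mulrAC ler_pM.
Qed.

Lemma growth_ge0 k : 0 <= r k.
Proof. by rewrite divr_ge0 ?(ltW (beta_gt0 k))// subr_ge0 beta_nd. Qed.

Lemma growthE k : r k = beta k.+1 / beta k - 1.
Proof. by rewrite /r /fdiff mulrBl divff// gt_eqF. Qed.

(** With e_k = (1 - d) / beta_k, the factor (e_k - e_{k+1}) / e_{k+1} of
    [tikhonov_step] is the relative growth of beta. *)
Lemma tikhonov_drift k : `|y k.+1 - y k| <= r k * `|z|.
Proof.
have e0 j : 0 < (1 - d) / beta j by rewrite divr_gt0 ?subr_gt0.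
have bk : beta k <= beta k.+1 by exact: beta_nd.
have ele : (1 - d) / beta k.+1 <= (1 - d) / beta k.
  by rewrite ler_pM2l ?subr_gt0// lef_pV2 ?posrE.
have := tikhonov_step dotE f_proper (e0 k.+1) ele
  (tikhonov_point_subdiff k) (tikhonov_point_subdiff k.+1).
have -> : (1 - d) / beta k - (1 - d) / beta k.+1 = (1 - d) / beta k.+1 * r k.
  by rewrite growthE; field; rewrite !gt_eqF.
rewrite -[X in _ <= X]mulrA ler_pM2l// => /le_trans; apply.
rewrite ler_wpM2l ?growth_ge0//.
exact: (tikhonov_norm_le dotE f_proper (e0 k) zmin (tikhonov_point_subdiff k)).
Qed.

Context (ell : R) (ell_gt0 : 0 < ell)
  (beta_ratio : beta k.+1 / beta k @[k --> \oo] --> ell).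

Lemma growth_cvg : r k @[k --> \oo] --> ell - 1.
Proof. by under eq_fun do rewrite growthE; apply: cvgB => //; exact: cvg_cst. Qed.

Lemma beta_succ_le : \forall k \near \oo, beta k.+1 <= (ell + 1) * beta k.
Proof.
have /cvgr_le/(_ (ell + 1)) := beta_ratio.
rewrite ltrDl ltr01 => /(_ isT); apply: filterS => k.
by rewrite ler_pdivrMr.
Qed.

(** The estimates come at rank k + 1 with the parameter beta_k of the step; a
    bounded ratio of consecutive parameters makes up for the shift. *)
Lemma bound_shift (u : nat -> R) (C : R) : 0 < C ->
  (forall k, u k.+1 <= C / beta k) ->
  \forall k \near \oo, u k <= C * (ell + 1) * (1 / beta k).
Proof.
move=> C0 uC; have [N _ hN] := beta_succ_le.
exists N.+1 => // -[//|k] /= Nk; apply: (le_trans (uC k)).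
rewrite div1r -mulrA ler_pM2l// ler_pdivlMr// mulrC ler_pdivrMr//.
exact: hN.
Qed.

(** The drift enters squared, as r_k^2 |z|^2; as r_k is eventually at most ell, one
    of its two factors goes into the constant. *)
Lemma sqr_gap_rec : exists2 C, 0 <= C & \forall k \near \oo,
  `|x k.+1 - y k.+1| ^+ 2 <= d * `|x k - y k| ^+ 2 + C * r k.
Proof.
exists (ell * `|z| ^+ 2 / (1 - d)).
  by rewrite divr_ge0 ?subr_ge0 ?(ltW d1)// mulr_ge0 ?sqr_ge0 ?ltW.
have /cvgr_le/(_ ell) := growth_cvg.
rewrite ltrBlDr ltrDl ltr01 => /(_ isT); apply: filterS => k rl.
have := tikhonov_contraction k; have := tikhonov_drift k; have := growth_ge0 k.
have : `|x k.+1 - y k.+1| <= `|x k.+1 - y k| + `|y k.+1 - y k|.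
  by rewrite (distrC (y k.+1)); exact: ler_distD.
move: (normr_ge0 (x k.+1 - y k.+1)) (normr_ge0 (x k - y k)) (normr_ge0 z).
move: (normr_ge0 (y k.+1 - y k)) rl.
move: `|x k.+1 - y k.+1| `|x k.+1 - y k| `|y k.+1 - y k| `|x k - y k| `|z| (r k).
move=> a' b c a m s c0 sl a'0 a0 m0 ha s0 hc hb.
have a'le : a' <= d * a + c by lra.
have d1' : 0 < 1 - d by rewrite subr_gt0.
(* Young's inequality in convex form: the squared increment of the target is
   divided by 1 - d, and the factor d on the squared gap is kept. *)
have cvx : (d * a + c) ^+ 2 <= d * a ^+ 2 + c ^+ 2 / (1 - d).
  rewrite -subr_ge0.
  have -> : d * a ^+ 2 + c ^+ 2 / (1 - d) - (d * a + c) ^+ 2 =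
      d / (1 - d) * ((1 - d) * a - c) ^+ 2.
    by field; rewrite gt_eqF.
  by rewrite mulr_ge0 ?sqr_ge0// divr_ge0 ?ltW.
apply: (@le_trans _ _ ((d * a + c) ^+ 2)).
  by rewrite lerXn2r ?nnegrE// (le_trans a'0).
apply: (le_trans cvx); rewrite lerD2l [X in _ <= X]mulrAC ler_pM2r ?invr_gt0//.
apply: (@le_trans _ _ ((s * m) ^+ 2)); first by rewrite lerXn2r ?nnegrE// mulr_ge0.
rewrite exprMn [X in _ <= X]mulrAC ler_wpM2r ?sqr_ge0// expr2 ler_wpM2r//.
Qed.

Context (dbeta_ratio : fdiff beta k.+1 / fdiff beta k @[k --> \oo] --> ell)
  (rho : R) (rho_itv : 0 < rho < 1 - d).

Let rate k := r k + expR (- (rho * k%:R)).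

(** The growth is the quotient of the two sequences whose ratios tend to the same
    ell. *)
Lemma growth_ratio_cvg1 : r k.+1 / r k @[k --> \oo] --> (1 : R).
Proof.
rewrite -(divff (lt0r_neq0 ell_gt0)).
under eq_fun => k.
  rewrite (_ : r k.+1 / r k =
    fdiff beta k.+1 / fdiff beta k / (beta k.+1 / beta k)); last first.
    by rewrite /r !invfM !invrK; ring.
  over.
apply: cvgM => //; apply: cvgV => //; exact: lt0r_neq0.
Qed.

Lemma sqr_gap_rate : exists2 M, 0 < M &
  \forall k \near \oo, `|x k - y k| ^+ 2 <= M * rate k.
Proof.
have [C C0 hC] := sqr_gap_rec.
exact: (recursion_bound (a := fun k => `|x k - y k| ^+ 2) d01 rho_itv C0
  growth_ge0 hC growth_ratio_cvg1).
Qed.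

Lemma rate_cvg0 : ell = 1 -> rate k @[k --> \oo] --> (0 : R).
Proof.
move=> ell1; rewrite -[X in _ --> X]addr0; apply: cvgD.
  by rewrite -[X in _ --> X](subrr 1) -{1}ell1; exact: growth_cvg.
have rho0 : 0 < rho by case/andP: rho_itv.
have q1 : `|expR (- rho)| < 1 by rewrite gtr0_norm ?expR_gt0// expR_lt1 oppr_lt0.
under eq_fun do rewrite -mulNr mulrC expRM_natl.
exact: cvg_expr.
Qed.

Lemma gap_cvg0 : ell = 1 -> (x k - y k) @[k --> \oo] --> (0 : H).
Proof.
move=> ell1; have [M M0 hM] := sqr_gap_rate.
apply/cvgrPdist_le => eps eps0.
have Me : 0 < eps ^+ 2 / M by rewrite divr_gt0 ?exprn_gt0.
have /cvgr_le/(_ _ Me) := rate_cvg0 ell1.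
apply: filterS2 hM => k hk.
rewrite ler_pdivlMr// mulrC => /(le_trans hk).
by rewrite sub0r normrN ler_pXn2r// nnegrE ?normr_ge0 ?(ltW eps0).
Qed.

(** Both x_{k+1} and x_k are within |x_k - y_k| of y_k. *)
Lemma sqr_velocity_rate : exists2 M, 0 < M &
  \forall k \near \oo, `|fdiff x k| ^+ 2 <= M * rate k.
Proof.
have [M M0 hM] := sqr_gap_rate; exists (4 * M); first by rewrite mulr_gt0.
apply: filterS hM => k hk; rewrite -mulrA; apply: (@le_trans _ _ (4 * `|x k - y k| ^+ 2)).
  have -> : 4 * `|x k - y k| ^+ 2 = (2 * `|x k - y k|) ^+ 2 by ring.
  rewrite lerXn2r ?nnegrE ?mulr_ge0// mulr_natl mulr2n.
  apply: (le_trans (ler_distD (y k) _ _)); rewrite (distrC (y k)) lerD2r.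
  by apply: (le_trans (tikhonov_contraction k)); rewrite ler_piMl// ltW.
by rewrite ler_pM2l.
Qed.

Lemma iterate_cvg : ell = 1 -> beta k @[k --> \oo] --> +oo ->
  exists2 xstar, is_min_norm (argmin f) xstar & x k @[k --> \oo] --> xstar.
Proof.
move=> ell1 beta_oo.
have [xstar xmin yx] : exists2 xstar, is_min_norm (argmin f) xstar &
    y k @[k --> \oo] --> xstar.
  apply: (tikhonov_cvg dotE f_proper f_lsc (e := fun k => (1 - d) / beta k)).
  - by exists z.
  - by move=> k; rewrite divr_gt0 ?subr_gt0.
  - by move=> n k nk; rewrite ler_pM2l ?subr_gt0// lef_pV2 ?posrE//; exact: beta_nd.
  - rewrite -[X in _ --> X](mulr0 (1 - d)); apply: cvgMr.
    by apply/gtr0_cvgV0 => //; apply: nearW.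
  - exact: tikhonov_point_subdiff.
exists xstar => //; rewrite -[xstar]add0r.
have -> : x = (fun k => (x k - y k) + y k) by apply/funext => k; rewrite subrK.
by apply: cvgD => //; exact: gap_cvg0.
Qed.

End DampedProx.

Theorem theorem5p3 (R : realType) (H : completeNormedModType R)
  (dot : {dot H for idfun}) (dotE : forall x : H, dot x x = `|x| ^+ 2)
  (f : H -> \bar R) (f_proper : proper_fun f) (f_lsc : lower_semicontinuous f)
  (f_convex : convex_ereal f) (f_argmin : argmin f !=set0)
  (d : R) (d01 : 0 < d < 1)
  (beta : nat -> R) (beta_nd : nondecreasing_seq beta)
  (beta_gt0 : forall k, 0 < beta k)
  (beta_oo : beta k @[k --> \oo] --> +oo)
  (dbeta_neq0 : \forall k \near \oo, fdiff beta k != 0)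
  (ell : R) (ell_gt0 : 0 < ell)
  (dbeta_ratio : fdiff beta k.+1 / fdiff beta k @[k --> \oo] --> ell)
  (beta_ratio : beta k.+1 / beta k @[k --> \oo] --> ell)
  (x : nat -> H) (x_algo : forall k, x k.+1 = prox (beta k) f (d *: x k))
  (rho : R) (rho_itv : 0 < rho < 1 - d) :
  [/\ [/\ ereal_bigO (fun k => f (x k) - minval f)%E (fun k => 1 / beta k),
          (fun k => `|fdiff x k| ^+ 2 : R^o) =O_\oo
            (fun k => fdiff beta k / beta k + expR (- (rho * k%:R)) : R^o)
        & (fun k => `|x k - tikhonov_min d beta f k| ^+ 2 : R^o) =O_\oo
            (fun k => fdiff beta k / beta k + expR (- (rho * k%:R)) : R^o)],
      ell = 1 ->
        exists2 xstar : H, is_min_norm (argmin f) xstar &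
          x k @[k --> \oo] --> xstar
    & ereal_bigO (fun k => dist0 (subdiff dot f (x k.+1)))
        (fun k => 1 / beta k) /\
      ((forall z, f z \is a fin_num) ->
       (forall z : H, differentiable (fine \o f : H -> R^o) z) ->
       (gradient dot f (x k) @[k --> \oo] --> (0 : H)) /\
       (fun k => `|gradient dot f (x k)| : R^o) =O_\oo
         (fun k => 1 / beta k : R^o))].
Proof.
case: f_argmin => z zmin.
have zfin := argmin_fin f_proper zmin.
have xfin k := subdiff_fin f_proper (iterate_subdiff dotE f_proper f_lsc f_convex
  zmin beta_gt0 x_algo k).
have xsub := iterate_subdiff dotE f_proper f_lsc f_convex zmin beta_gt0 x_algo.
have [C C0 hC] := subgradient_bounded dotE f_proper f_lsc f_convex zmin d01
  beta_gt0 x_algo.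
split; first split.
- rewrite (minvalE zmin).
  have gap_fin k : (f (x k.+1) - f z)%E \is a fin_num by rewrite fin_numB xfin.
  split; first by exists 1%N => // -[|k].
  have [G G0 hG] := objective_gap dotE f_proper f_lsc f_convex zmin d01 beta_gt0 x_algo.
  apply: (@eqO_near _ _ _ _ (G * (ell + 1))); first by rewrite mulr_gt0// addr_gt0.
  apply: (bound_shift beta_gt0 beta_ratio (u := fun k => `|fine (f (x k) - f z)|)) => // k.
  rewrite ger0_norm; first by rewrite fineB.
  by rewrite fine_ge0// subre_ge0.
- have [M M0 hM] := sqr_velocity_rate dotE f_proper f_lsc f_convex zmin d01 beta_nd
    beta_gt0 x_algo ell_gt0 beta_ratio dbeta_ratio rho_itv.
  apply: (eqO_near M0); apply: filterS hM => k.
  by rewrite ger0_norm// sqr_ge0.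
- have [M M0 hM] := sqr_gap_rate dotE f_proper f_lsc f_convex zmin d01 beta_nd
    beta_gt0 x_algo ell_gt0 beta_ratio dbeta_ratio rho_itv.
  apply: (eqO_near M0); apply: filterS hM => k.
  by rewrite ger0_norm// sqr_ge0.
- move=> ell1.
  exact: (iterate_cvg dotE f_proper f_lsc f_convex zmin d01 beta_nd beta_gt0
    x_algo ell_gt0 beta_ratio dbeta_ratio rho_itv).
split.
  split; first by apply: nearW => k; case: (dist0_mem_le (xsub k)).
  apply: (eqO_near C0); apply: nearW => k; rewrite /= div1r.
  have [_ /andP[ge0 le]] := dist0_mem_le (xsub k).
  by rewrite ger0_norm// (le_trans le).
move=> ffin fdiff.
have grad_le : \forall k \near \oo, `|gradient dot f (x k)| <= C * (ell + 1) * (1 / beta k).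
  apply: (bound_shift beta_gt0 beta_ratio (u := fun k => `|gradient dot f (x k)|)) => // k.
  by rewrite (gradient_eq_subgradient dotE ffin (fdiff _) (xsub k)).
have C1 : 0 < C * (ell + 1) by rewrite mulr_gt0// addr_gt0.
split; last first.
  by apply: (eqO_near C1); apply: filterS grad_le => k; rewrite normr_id.
have beta_inv0 : C * (ell + 1) * (1 / beta k) @[k --> \oo] --> (0 : R).
  rewrite -[X in _ --> X](mulr0 (C * (ell + 1))); apply: cvgMr.
  under eq_fun do rewrite div1r.
  by apply/gtr0_cvgV0 => //; exact: nearW.
apply/norm_cvg0P; apply: (squeeze_cvgr _ (cvg_cst 0) beta_inv0).
by apply: filterS grad_le => k ->; rewrite normr_ge0.
Qed.
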